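(* For any field $k$, the PROP $\mathtt{FinVect}_k$ is generated by the following morphisms, i.e. every morphism of $\mathtt{FinVect}_k$ can be obtained from them using composition, tensor product (direct sum), identity morphisms and the braiding: (1) scaling $s_c\colon k\to k$, $x\mapsto cx$, for any $c\in k$; (2) addition $+\colon k\oplus k\to k$, $(x,y)\mapsto x+y$; (3) zero $0\colon\{0\}\to k$, the unique linear map; (4) duplication $\Delta\colon k\to k\oplus k$, $x\mapsto(x,x)$; (5) deletion $!\colon k\to\{0\}$, the unique linear map.
   Context: A PROP is a strict symmetric monoidal category whose objects are the natural numbers, with monoidal product of objects given by addition. $\mathtt{FinVect}_k$ is the PROP whose morphisms $m\to n$ are the linear maps $k^m\to k^n$, with the usual composition, with direct sum as tensor product, and with braiding $(x,y)\mapsto(y,x)$. *)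

(* Defs.v *)
From HB Require Import structures.
From mathcomp Require Import all_boot all_order all_algebra.
Set Implicit Arguments.
Unset Strict Implicit.
Unset Printing Implicit Defensive.
Import GRing.Theory.
Local Open Scope ring_scope.

(* Transport of a morphism along equalities of objects.  In a strict category
   (m + n) + p and m + (n + p) are the same object, but the hom-types are only
   provably equal; hcast makes that identification explicit. *)
Definition hcast (H : nat -> nat -> Type) (m m' n n' : nat)
    (em : m = m') (en : n = n') (f : H m n) : H m' n' :=
  match em in _ = m0, en in _ = n0 return H m0 n0 with
  | erefl, erefl => f
  end.

Record PROP := MkPROP {
  hom : nat -> nat -> Type;
  idm : forall m, hom m m;
  (* comp g f is "g after f" *)
  comp : forall m n p, hom n p -> hom m n -> hom m p;
  tens : forall m n p q, hom m n -> hom p q -> hom (m + p) (n + q);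
  braid : forall m n, hom (m + n) (n + m);
  comp_idl : forall m n (f : hom m n), comp (idm n) f = f;
  comp_idr : forall m n (f : hom m n), comp f (idm m) = f;
  comp_assoc : forall m n p q (h : hom p q) (g : hom n p) (f : hom m n),
    comp h (comp g f) = comp (comp h g) f;
  tens_id : forall m n, tens (idm m) (idm n) = idm (m + n);
  tens_comp : forall m n p m' n' p' (g : hom n p) (f : hom m n)
      (g' : hom n' p') (f' : hom m' n'),
    tens (comp g f) (comp g' f') = comp (tens g g') (tens f f');
  tens_unitl : forall m n (f : hom m n),
    hcast (add0n m) (add0n n) (tens (idm 0) f) = f;
  tens_unitr : forall m n (f : hom m n),
    hcast (addn0 m) (addn0 n) (tens f (idm 0)) = f;
  tens_assoc : forall m n p m' n' p'
      (f : hom m m') (g : hom n n') (h : hom p p'),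
    hcast (addnA m n p) (addnA m' n' p') (tens f (tens g h))
      = tens (tens f g) h;
  braid_nat : forall m n m' n' (f : hom m m') (g : hom n n'),
    comp (braid m' n') (tens f g) = comp (tens g f) (braid m n);
  braid_sym : forall m n, comp (braid n m) (braid m n) = idm (m + n);
  braid_hexagon : forall m n p,
    hcast (addnA m n p) (esym (addnA n p m)) (braid m (n + p)%N)
      = comp (tens (idm n) (braid m p))
             (hcast (erefl (m + n + p)%N) (esym (addnA n m p))
                    (tens (braid m n) (idm p)))
}.

Arguments idm {_} m : rename.
Arguments comp {_ m n p} _ _ : rename.
Arguments tens {_ m n p q} _ _ : rename.
Arguments braid {_} m n : rename.

(* The morphisms obtained from S by composition, tensor product, identities and
   the braiding.  Closure under hcast is automatic, by elimination of the
   equalities of objects. *)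
Inductive generated (P : PROP) (S : forall m n, hom P m n -> Prop) :
    forall m n, hom P m n -> Prop :=
| generated_gen m n (f : hom P m n) : S m n f -> generated S f
| generated_id m : generated S (idm m : hom P m m)
| generated_braid m n : generated S (braid m n : hom P (m + n) (n + m))
| generated_comp m n p (g : hom P n p) (f : hom P m n) :
    generated S g -> generated S f -> generated S (comp g f)
| generated_tens m n p q (f : hom P m n) (g : hom P p q) :
    generated S f -> generated S g -> generated S (tens f g).

Definition PROP_generated_by (P : PROP) (S : forall m n, hom P m n -> Prop) :=
  forall m n (f : hom P m n), generated S f.

Section FinVect.
Variable k : fieldType.
Implicit Types m n p q : nat.

(* k^n is 'rV[k]_n, and the pair (x, y) in k^m (+) k^n = k^(m + n) is
   row_mx x y. *)

Definition dsum_fun m n p q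
    (f : 'Hom('rV[k]_m, 'rV[k]_n)) (g : 'Hom('rV[k]_p, 'rV[k]_q))
    (v : 'rV[k]_(m + p)) : 'rV[k]_(n + q) :=
  row_mx (f (lsubmx v)) (g (rsubmx v)).

Definition swap_fun m n (v : 'rV[k]_(m + n)) : 'rV[k]_(n + m) :=
  row_mx (rsubmx v) (lsubmx v).

Definition add_fun (v : 'rV[k]_(1 + 1)) : 'rV[k]_1 := lsubmx v + rsubmx v.

Definition dup_fun (v : 'rV[k]_1) : 'rV[k]_(1 + 1) := row_mx v v.

Fact dsum_fun_linear m n p q (f : 'Hom('rV[k]_m, 'rV[k]_n))
  (g : 'Hom('rV[k]_p, 'rV[k]_q)) : linear (dsum_fun f g).
Proof.
by move=> a u v; rewrite /dsum_fun !linearP /= scale_row_mx add_row_mx.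
Qed.
HB.instance Definition _ m n p q (f : 'Hom('rV[k]_m, 'rV[k]_n))
    (g : 'Hom('rV[k]_p, 'rV[k]_q)) :=
  GRing.isLinear.Build k _ _ _ (dsum_fun f g) (dsum_fun_linear f g).

Fact swap_fun_linear m n : linear (@swap_fun m n).
Proof.
by move=> a u v; rewrite /swap_fun !linearP /= scale_row_mx add_row_mx.
Qed.
HB.instance Definition _ m n :=
  GRing.isLinear.Build k _ _ _ (@swap_fun m n) (@swap_fun_linear m n).

Fact add_fun_linear : linear add_fun.
Proof. by move=> a u v; rewrite /add_fun !linearP /= scalerDr addrACA. Qed.
HB.instance Definition _ :=
  GRing.isLinear.Build k _ _ _ add_fun add_fun_linear.

Fact dup_fun_linear : linear dup_fun.
Proof. by move=> a u v; rewrite /dup_fun scale_row_mx add_row_mx. Qed.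
HB.instance Definition _ :=
  GRing.isLinear.Build k _ _ _ dup_fun dup_fun_linear.

Definition fv_hom m n : Type := 'Hom('rV[k]_m, 'rV[k]_n).
Definition fv_id m : fv_hom m m := \1%VF.
Definition fv_comp m n p (g : fv_hom n p) (f : fv_hom m n) : fv_hom m p :=
  (g \o f)%VF.
Definition fv_tens m n p q (f : fv_hom m n) (g : fv_hom p q) :
  fv_hom (m + p) (n + q) := linfun (dsum_fun f g).
Definition fv_braid m n : fv_hom (m + n) (n + m) := linfun (@swap_fun m n).

Lemma fv_tensE m n p q (f : fv_hom m n) (g : fv_hom p q) x y :
  fv_tens f g (row_mx x y) = row_mx (f x) (g y).
Proof. by rewrite lfunE /= /dsum_fun row_mxKl row_mxKr. Qed.

Lemma fv_braidE m n (x : 'rV[k]_m) (y : 'rV[k]_n) :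
  fv_braid m n (row_mx x y) = row_mx y x.
Proof. by rewrite lfunE /= /swap_fun row_mxKl row_mxKr. Qed.

Lemma fv_hcastE m m' n n' (em : m = m') (en : n = n') (f : fv_hom m n) v :
  (hcast em en f : fv_hom m' n') v
    = castmx (erefl, en) (f (castmx (erefl, esym em) v)).
Proof. by case: m' / em v; case: n' / en => v; rewrite !castmx_id. Qed.

Lemma fv_row_mxA m n p (x : 'rV[k]_m) (y : 'rV[k]_n) (z : 'rV[k]_p) e :
  castmx (erefl 1%N, e) (row_mx (row_mx x y) z) = row_mx x (row_mx y z).
Proof. by rewrite row_mxA; congr castmx; congr pair; apply: eq_irrelevance. Qed.

Lemma fv_row_mxAV m n p (x : 'rV[k]_m) (y : 'rV[k]_n) (z : 'rV[k]_p) e :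
  castmx (erefl 1%N, e) (row_mx x (row_mx y z)) = row_mx (row_mx x y) z.
Proof.
rewrite row_mxA castmx_comp /=.
by rewrite (eq_irrelevance (etrans _ _) erefl) castmx_id.
Qed.

Fact fv_comp_idl m n (f : fv_hom m n) : fv_comp (fv_id n) f = f.
Proof. exact: comp_lfun1l. Qed.

Fact fv_comp_idr m n (f : fv_hom m n) : fv_comp f (fv_id m) = f.
Proof. exact: comp_lfun1r. Qed.

Fact fv_comp_assoc m n p q (h : fv_hom p q) (g : fv_hom n p) (f : fv_hom m n) :
  fv_comp h (fv_comp g f) = fv_comp (fv_comp h g) f.
Proof. exact: comp_lfunA. Qed.

Fact fv_tens_id m n : fv_tens (fv_id m) (fv_id n) = fv_id (m + n).
Proof. by apply/lfunP => v; rewrite -[v]hsubmxK fv_tensE !id_lfunE. Qed.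

Fact fv_tens_comp m n p m' n' p' (g : fv_hom n p) (f : fv_hom m n)
    (g' : fv_hom n' p') (f' : fv_hom m' n') :
  fv_tens (fv_comp g f) (fv_comp g' f') = fv_comp (fv_tens g g') (fv_tens f f').
Proof.
by apply/lfunP => v; rewrite -[v]hsubmxK !(comp_lfunE, fv_tensE).
Qed.

Fact fv_tens_unitl m n (f : fv_hom m n) :
  hcast (add0n m) (add0n n) (fv_tens (fv_id 0) f) = f.
Proof.
apply/lfunP => v; rewrite fv_hcastE -[castmx (_, esym _) v]hsubmxK fv_tensE.
rewrite row_thin_mx (eq_irrelevance (add0n n) erefl) castmx_id; congr (f _).
rewrite (eq_irrelevance (esym _) erefl) castmx_id.
by rewrite -[v in RHS](@hsubmxK _ 1 0 m) row_thin_mx.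
Qed.

Fact fv_tens_unitr m n (f : fv_hom m n) :
  hcast (addn0 m) (addn0 n) (fv_tens f (fv_id 0)) = f.
Proof.
have row0 p (x : 'rV[k]_p) (y : 'rV[k]_0) e :
    castmx (erefl 1%N, e) (row_mx x y) = x.
  apply/rowP => i; rewrite castmxE /= (_ : cast_ord _ i = lshift 0 i).
    by rewrite row_mxEl cast_ord_id.
  exact: val_inj.
apply/lfunP => v; rewrite fv_hcastE.
have -> : castmx (erefl 1%N, esym (addn0 m)) v = row_mx v 0.
  by have := castmxK (erefl 1%N) (addn0 m) (row_mx v 0); rewrite row0.
by rewrite fv_tensE row0.
Qed.

Fact fv_tens_assoc m n p m' n' p'
    (f : fv_hom m m') (g : fv_hom n n') (h : fv_hom p p') :
  hcast (addnA m n p) (addnA m' n' p') (fv_tens f (fv_tens g h))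
    = fv_tens (fv_tens f g) h.
Proof.
apply/lfunP => v; rewrite -[v]hsubmxK -[lsubmx v]hsubmxK fv_hcastE.
by rewrite fv_row_mxA !fv_tensE fv_row_mxAV.
Qed.

Fact fv_braid_nat m n m' n' (f : fv_hom m m') (g : fv_hom n n') :
  fv_comp (fv_braid m' n') (fv_tens f g)
    = fv_comp (fv_tens g f) (fv_braid m n).
Proof.
by apply/lfunP => v; rewrite -[v]hsubmxK !(comp_lfunE, fv_tensE, fv_braidE).
Qed.

Fact fv_braid_sym m n : fv_comp (fv_braid n m) (fv_braid m n) = fv_id (m + n).
Proof.
by apply/lfunP => v; rewrite -[v]hsubmxK !(comp_lfunE, id_lfunE, fv_braidE).
Qed.

Fact fv_braid_hexagon m n p :
  hcast (addnA m n p) (esym (addnA n p m)) (fv_braid m (n + p))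
    = fv_comp (fv_tens (fv_id n) (fv_braid m p))
        (hcast (erefl (m + n + p)%N) (esym (addnA n m p))
               (fv_tens (fv_braid m n) (fv_id p))).
Proof.
apply/lfunP => v; rewrite -[v]hsubmxK -[lsubmx v]hsubmxK.
rewrite comp_lfunE !fv_hcastE castmx_id fv_row_mxA !(fv_tensE, fv_braidE).
by rewrite id_lfunE !fv_row_mxA fv_tensE fv_braidE id_lfunE.
Qed.

Definition FinVect : PROP := MkPROP
  fv_comp_idl fv_comp_idr fv_comp_assoc fv_tens_id fv_tens_comp
  fv_tens_unitl fv_tens_unitr fv_tens_assoc
  fv_braid_nat fv_braid_sym fv_braid_hexagon.

Definition fv_scale (c : k) : hom FinVect 1 1 :=
  linfun (fun x : 'rV[k]_1 => c *: x).
Definition fv_add : hom FinVect 2 1 := linfun add_fun.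
Definition fv_zero : hom FinVect 0 1 := 0 : 'Hom('rV[k]_0, 'rV[k]_1).
Definition fv_dup : hom FinVect 1 2 := linfun dup_fun.
Definition fv_del : hom FinVect 1 0 := 0 : 'Hom('rV[k]_1, 'rV[k]_0).

(* linfun is only meaningful on linear functions. *)
Lemma fv_scaleE c (x : 'rV[k]_1) : (fv_scale c : fv_hom 1 1) x = c *: x.
Proof. exact: lfunE. Qed.

Lemma fv_addE (x y : 'rV[k]_1) : (fv_add : fv_hom 2 1) (row_mx x y) = x + y.
Proof. by rewrite lfunE /= /add_fun row_mxKl row_mxKr. Qed.

Lemma fv_dupE (x : 'rV[k]_1) : (fv_dup : fv_hom 1 2) x = row_mx x x.
Proof. exact: lfunE. Qed.

Inductive fv_generator : forall m n, hom FinVect m n -> Prop :=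
| gen_scale (c : k) : fv_generator (fv_scale c)
| gen_add : fv_generator fv_add
| gen_zero : fv_generator fv_zero
| gen_dup : fv_generator fv_dup
| gen_del : fv_generator fv_del.

End FinVect.

(* Main.v *)
Require Import Defs.
From mathcomp Require Import all_boot all_order all_algebra.

Set Implicit Arguments.
Unset Strict Implicit.
Unset Printing Implicit Defensive.
Import GRing.Theory.
Local Open Scope ring_scope.

(** A linear map [k^m -> k^(1 + n)] is a functional [f] together with a linear
    map [g] to [k^n], and it factors as
      [x |-> (f x, x) |-> (f x, g x)].
    The second step is [id (+) g], so by induction on the codomain it suffices
    to generate the maps to [k^0], direct sums of deletions, and the graph
    [x |-> (f x, x)] of every functional (lemma [generated_graph]).

    The graph is obtained by induction on [m].  For [x = (c, y)] in
    [k (+) k^m] and [f x = a c + h y], it is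
      [(c, y) |-> (c, (h y, y)) = ((c, h y), y) |-> ((a c + h y, c), y)],
    that is, [id (+) graph h] followed by [u (+) id], where [u] is the map
    [(c, d) |-> (a c + d, c)] of [k (+) k]; and [u] is an explicit composite of
    duplication, scaling, addition and the braiding (lemma [generated_shear]).

    Splitting off the first coordinate each time makes the reassociations
    [1 + (1 + m) = (1 + 1) + m] hold by computation, so that no morphism has to
    be transported along an equality of objects. *)

Section Generation.
Variable k : fieldType.

Local Notation gen := (@generated (FinVect k) (@fv_generator k) _ _).

Definition mx_hom m n (M : 'M[k]_(m, n)) : fv_hom k m n :=
  linfun (mulmxr M).

Lemma mx_homE m n (M : 'M[k]_(m, n)) (v : 'rV[k]_m) :
  mx_hom M v = v *m M.
Proof. exact: lfunE. Qed.

Lemma mx_hom_lin1 m n (f : fv_hom k m n) : mx_hom (lin1_mx f) = f.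
Proof. by apply/lfunP => v; rewrite mx_homE mul_rV_lin1. Qed.

Lemma generated_ext m n (f g : fv_hom k m n) :
  gen f -> (forall v, f v = g v) -> gen g.
Proof. by move=> gen_f /lfunP <-. Qed.

Lemma generated_fv_id m : gen (fv_id k m).
Proof. exact: (@generated_id (FinVect k)). Qed.

Lemma generated_fv_comp m n p (g : fv_hom k n p) (f : fv_hom k m n) :
  gen g -> gen f -> gen (fv_comp g f).
Proof. exact: (@generated_comp (FinVect k)). Qed.

Lemma generated_fv_tens m n p q (f : fv_hom k m n) (g : fv_hom k p q) :
  gen f -> gen g -> gen (fv_tens f g).
Proof. exact: (@generated_tens (FinVect k)). Qed.

(** Associativity without a cast: [(1 + 1) + m] and [1 + (1 + m)] have the
    same normal form. *)
Lemma row_mxA_conv m (x y : 'rV[k]_1) (z : 'rV[k]_m) :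
  row_mx (row_mx x y) z = row_mx x (row_mx y z) :> 'rV[k]_(1 + (1 + m)).
Proof. by rewrite -(fv_row_mxA x y z (erefl _)) castmx_id. Qed.

(** The composite [(c, d) |-> (c, c, d) |-> (c, a c + d) |-> (a c + d, c)]; it
    keeps a copy of [c] while adding [a c] to the other coordinate. *)
Definition shear (a : k) : fv_hom k (1 + 1) (1 + 1) :=
  fv_comp (fv_braid k 1 1)
    (fv_comp (fv_tens (fv_id k 1)
                (fv_comp (fv_add k) (fv_tens (fv_scale a) (fv_id k 1))))
             (fv_tens (fv_dup k) (fv_id k 1))).

Lemma shearE a (c d : 'rV[k]_1) :
  shear a (row_mx c d) = row_mx (a *: c + d) c.
Proof.
rewrite /shear /fv_comp !comp_lfunE.
(* The intermediate objects [3 = (1 + 1) + 1 = 1 + (1 + 1)] and [2 = 1 + 1] are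
   only convertible, so unification needs the factors of the tensor products. *)
rewrite (fv_tensE (fv_dup k) (fv_id k 1) c d) fv_dupE id_lfunE row_mxA_conv.
rewrite fv_tensE comp_lfunE (fv_tensE (fv_scale a) (fv_id k 1) c d).
by rewrite fv_scaleE !id_lfunE fv_addE fv_braidE.
Qed.

Lemma generated_shear a : gen (shear a).
Proof.
apply: generated_fv_comp; first exact: (@generated_braid (FinVect k)).
apply: generated_fv_comp.
  apply: generated_fv_tens; first exact: generated_fv_id.
  apply: generated_fv_comp; first by apply: generated_gen; constructor.
  apply: (@generated_fv_tens 1 1 1 1); last exact: generated_fv_id.
  by apply: generated_gen; constructor.
apply: (@generated_fv_tens 1 2 1 1); last exact: generated_fv_id.
by apply: generated_gen; constructor.
Qed.

(** The graph of a functional duplicates the whole of [k^m] while using only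
    the duplication of [k]: each coordinate is copied when the induction
    reaches it, used once by the shear, and left in place. *)
Lemma generated_graph m (w : 'cV[k]_m) : gen (mx_hom (row_mx w 1%:M)).
Proof.
elim: m w => [|m IHm] w.
  apply: (@generated_ext 0 1 (fv_zero k)).
    by apply: generated_gen; constructor.
  by move=> v; rewrite (thinmx0 v) !linear0.
rewrite -[m.+1]/(1 + m)%N in w *.
set a := usubmx w 0 0; set h : 'cV_m := dsubmx w.
apply: (@generated_ext (1 + m) (1 + (1 + m))
  (fv_comp (fv_tens (shear a) (fv_id k m) : fv_hom k (1 + (1 + m)) _)
           (fv_tens (fv_id k 1) (mx_hom (row_mx h 1%:M))))).
  apply: generated_fv_comp.
    apply: (@generated_fv_tens 2 2 m m); first exact: generated_shear.
    exact: generated_fv_id.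
  by apply: generated_fv_tens; [exact: generated_fv_id | exact: IHm].
move=> v; rewrite -[v]hsubmxK.
set c := lsubmx v; set y := rsubmx v.
rewrite mx_homE comp_lfunE fv_tensE mx_homE !id_lfunE !mul_mx_row !mulmx1.
rewrite -row_mxA_conv (fv_tensE (shear a) (fv_id k m)) id_lfunE shearE.
rewrite row_mxA_conv.
congr (row_mx _ _); rewrite -[w in RHS]vsubmxK mul_row_col.
by rewrite [usubmx w]mx11_scalar mul_mx_scalar.
Qed.

Lemma generated_to0 m (f : fv_hom k m 0) : gen f.
Proof.
elim: m f => [|m IHm] f.
  apply: (@generated_ext 0 0 (fv_id k 0)); first exact: generated_fv_id.
  by move=> v; rewrite [LHS]thinmx0 [RHS]thinmx0.
apply: (@generated_ext (1 + m) 0 (fv_tens (fv_del k) (0 : fv_hom k m 0))).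
  apply: (@generated_fv_tens 1 0 m 0); last exact: IHm.
  by apply: generated_gen; constructor.
by move=> v; rewrite [LHS]thinmx0 [RHS]thinmx0.
Qed.

Lemma generated_mx_hom m n (M : 'M[k]_(m, n)) : gen (mx_hom M).
Proof.
elim: n M => [|n IHn] M; first exact: generated_to0.
rewrite -[n.+1]/(1 + n)%N in M *.
apply: (@generated_ext m (1 + n)
  (fv_comp (fv_tens (fv_id k 1) (mx_hom (rsubmx M)))
           (mx_hom (row_mx (lsubmx M) 1%:M)))).
  apply: generated_fv_comp; last exact: generated_graph.
  by apply: generated_fv_tens; [exact: generated_fv_id | exact: IHn].
move=> v; rewrite comp_lfunE !mx_homE mul_mx_row mulmx1 fv_tensE id_lfunE.
by rewrite mx_homE -mul_mx_row hsubmxK.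
Qed.

End Generation.

Theorem mainTheorem7 (k : fieldType) :
  PROP_generated_by (P := FinVect k) (@fv_generator k).
Proof.
by move=> m n f; rewrite -(mx_hom_lin1 f); apply: generated_mx_hom.
Qed.
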